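(* Let $L>0$ and $\rho\in(-\frac1{2L},0]$. Let $F:\mathbb{R}^n\to\mathbb{R}^n$ be $L$-Lipschitz, let $A:\mathbb{R}^n\rightrightarrows\mathbb{R}^n$ be maximally monotone, suppose $F+A$ is $\rho$-comonotone, and suppose $\mathrm{Zer}(F+A)\ne\emptyset$. Let $z_0\in\mathbb{R}^n$ be any starting point and let $\{z_k,z_{k+\frac12}\}_{k\ge1}$ be the iterates of composite-FEG with step size $\eta\in(\max(0,-2\rho),\frac1L]$. Let $H_0^2=\min_{z^*\in\mathrm{Zer}(F+A)}\|z_0-z^*\|^2$. Then for every integer $T\ge1$, $$r^{tan}_{F,A}(z_T)^2=\min_{c\in A(z_T)}\|F(z_T)+c\|^2\le\frac{4}{(\eta+2\rho)^2L^2}\cdot\frac{H_0^2L^2}{T^2}.$$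
   Context: $\mathbb{R}^n$ carries the Euclidean inner product $\langle\cdot,\cdot\rangle$ and norm $\|\cdot\|$. A set-valued operator $E:\mathbb{R}^n\rightrightarrows\mathbb{R}^n$ is $\rho$-comonotone if $\langle u-u',z-z'\rangle\ge\rho\|u-u'\|^2$ for all $z,z'$ and all $u\in E(z)$, $u'\in E(z')$; it is monotone if it is $0$-comonotone, and maximally monotone if it is monotone and its graph is not strictly contained in the graph of another monotone operator. $(F+A)(z)=\{F(z)+c: c\in A(z)\}$, $\mathrm{Zer}(F+A)=\{z:0\in F(z)+A(z)\}$. The resolvent is $J_{\eta A}=(I+\eta A)^{-1}$, which for maximally monotone $A$ and $\eta>0$ is single-valued and defined on all of $\mathbb{R}^n$. The tangent residual is $r^{tan}_{F,A}(z)=\min_{c\in A(z)}\|F(z)+c\|$. composite-FEG: given $z_0\in\mathbb{R}^n$, $\eta>0$ and $\rho$, put $c_0=0$, $\beta_k=\frac1{k+1}$, and for $k\ge0$ $$z_{k+\frac12}=\beta_kz_0+(1-\beta_k)z_k-(1-\beta_k)(\eta+2\rho)(F(z_k)+c_k),$$ $$z_{k+1}=J_{\eta A}\big[\beta_kz_0+(1-\beta_k)z_k-\eta F(z_{k+\frac12})-2(1-\beta_k)\rho(F(z_k)+c_k)\big],$$ $$c_{k+1}=\frac{\beta_kz_0+(1-\beta_k)z_k-\eta F(z_{k+\frac12})-2(1-\beta_k)\rho(F(z_k)+c_k)-z_{k+1}}{\eta}.$$ *)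

(* Defs.v *)
From mathcomp Require Import all_boot all_order all_algebra.
From mathcomp Require Import all_classical all_reals.

Set Implicit Arguments.
Unset Strict Implicit.
Unset Printing Implicit Defensive.

Import Order.TTheory GRing.Theory Num.Theory.
Local Open Scope classical_set_scope.
Local Open Scope ring_scope.

(* R^n is 'rV[R]_n. The norm `|_| that MathComp-Analysis puts on matrices is
   the sup norm, hence the separate Euclidean inner product and norm. *)
Definition dot (R : realType) (n : nat) (u v : 'rV[R]_n) : R :=
  \sum_(i < n) u ord0 i * v ord0 i.

Definition enorm (R : realType) (n : nat) (u : 'rV[R]_n) : R :=
  Num.sqrt (dot u u).

Definition euclidean_lipschitz (R : realType) (n : nat) (L : R)
    (F : 'rV[R]_n -> 'rV[R]_n) : Prop :=
  forall x y, enorm (F x - F y) <= L * enorm (x - y).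

Definition operator (R : realType) (n : nat) : Type :=
  'rV[R]_n -> set 'rV[R]_n.

Definition graph (R : realType) (n : nat) (E : operator R n) :
    set ('rV[R]_n * 'rV[R]_n) :=
  [set p | E p.1 p.2].

Definition comonotone (R : realType) (n : nat) (rho : R) (E : operator R n) :
    Prop :=
  forall z z' u u', E z u -> E z' u' ->
    rho * enorm (u - u') ^+ 2 <= dot (u - u') (z - z').

Definition monotone (R : realType) (n : nat) (E : operator R n) : Prop :=
  comonotone 0 E.

Definition maximally_monotone (R : realType) (n : nat) (E : operator R n) :
    Prop :=
  monotone E /\
  ~ (exists E' : operator R n, monotone E' /\ graph E `<` graph E').

Definition op_add (R : realType) (n : nat) (F : 'rV[R]_n -> 'rV[R]_n)
    (A : operator R n) : operator R n :=
  fun z => [set F z + c | c in A z].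

Definition zer (R : realType) (n : nat) (E : operator R n) : set 'rV[R]_n :=
  [set z | E z 0].

(* The set-valued inverse of I + eta A; z = J_{eta A}(w) is expressed by
   [resolvent eta A w z]. When A is maximally monotone and eta > 0 this set
   is a singleton for every w. *)
Definition resolvent (R : realType) (n : nat) (eta : R) (A : operator R n) :
    operator R n :=
  fun w => [set z | op_add id (fun x => [set eta *: a | a in A x]) z w].

Definition is_min (R : realType) (S : set R) (m : R) : Prop :=
  S m /\ lbound S m.

Definition is_tangent_residual (R : realType) (n : nat)
    (F : 'rV[R]_n -> 'rV[R]_n) (A : operator R n) (z : 'rV[R]_n) (r : R) :
    Prop :=
  is_min [set enorm (F z + c) | c in A z] r.

Definition FEG_beta (R : realType) (k : nat) : R := k.+1%:R^-1.

(* The argument of the resolvent in the k-th step; [zk], [zhk], [ck] stand for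
   z_k, z_{k+1/2}, c_k. *)
Definition FEG_arg (R : realType) (n : nat) (F : 'rV[R]_n -> 'rV[R]_n)
    (eta rho : R) (z0 : 'rV[R]_n) (k : nat) (zk zhk ck : 'rV[R]_n) :
    'rV[R]_n :=
  FEG_beta R k *: z0 + (1 - FEG_beta R k) *: zk - eta *: F zhk
  - (2 * (1 - FEG_beta R k) * rho) *: (F zk + ck).

(* [zh k] stands for z_{k+1/2}. *)
Record composite_FEG (R : realType) (n : nat) (F : 'rV[R]_n -> 'rV[R]_n)
    (A : operator R n) (eta rho : R) (z0 : 'rV[R]_n)
    (z zh c : nat -> 'rV[R]_n) : Prop := {
  FEG_z0 : z 0%N = z0;
  FEG_c0 : c 0%N = 0;
  FEG_half : forall k, zh k =
    FEG_beta R k *: z0 + (1 - FEG_beta R k) *: z k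
    - ((1 - FEG_beta R k) * (eta + 2 * rho)) *: (F (z k) + c k);
  FEG_next : forall k,
    resolvent eta A (FEG_arg F eta rho z0 k (z k) (zh k) (c k)) (z k.+1);
  FEG_c : forall k, c k.+1 =
    eta^-1 *: (FEG_arg F eta rho z0 k (z k) (zh k) (c k) - z k.+1)
}.

(* Main.v *)
Require Import Defs.
From mathcomp Require Import all_boot all_order all_algebra.
From mathcomp Require Import all_classical all_reals.
From mathcomp Require Import topology normedtype derive.
From mathcomp Require Import ring lra.

Set Implicit Arguments.
Unset Strict Implicit.
Unset Printing Implicit Defensive.

Import Order.TTheory GRing.Theory Num.Theory.
Import numFieldNormedType.Exports.
Local Open Scope classical_set_scope.
Local Open Scope ring_scope.

(** The rate comes from a Lyapunov function. Write u_k = F(z_k) + c_k and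
    w_k = F(z_{k+1/2}) + c_{k+1}. Because the resolvent step puts c_{k+1} in
    A(z_{k+1}), each u_{k+1} is a value of F + A at z_{k+1}, and the scheme reads

      z_{k+1} = b z_0 + (1 - b) z_k - eta w_k - 2 (1 - b) rho u_k,
      z_{k+1} - z_{k+1/2} = - eta (w_k - (1 - b) u_k),      b = 1 / (k + 1).

    Two inequalities are available: rho-comonotonicity between z_k and
    z_{k+1}, and, from the Lipschitz bound together with eta L <= 1,
    |u_{k+1} - w_k| <= |w_k - (1 - b) u_k|  ([FEG_lipschitz_step]).
    Weighted by k (k + 1) and by eta (k + 1)^2 / 2, their slacks add up exactly
    to V_k - V_{k+1}, where

      V_k = (eta k^2 / 2 + rho (k^2 - k)) |u_k|^2 + k <u_k, z_k - z_0>

    ([potential_step]). As V_0 = 0, every V_k is nonpositive. Comonotonicity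
    between z_T and a zero z* then turns V_T <= 0 into
    (eta + 2 rho) T / 2 |u_T|^2 <= <u_T, z_0 - z*>, and Cauchy-Schwarz gives
    |u_T| <= 2 |z_0 - z*| / ((eta + 2 rho) T)  ([potential_le0_residual]). The
    tangent residual at z_T is at most |u_T|.

    The two minima in the statement, over the zeros of F + A and over A(z_T),
    are attained because both sets are nonempty and closed in a
    finite-dimensional space. Closedness follows from maximality: A(z) contains
    u as soon as (z, u) is monotonically related to the whole graph of A
    ([maximally_monotone_mem]), so membership is an intersection of closed
    conditions ([maximally_monotone_closed_preimage]). *)

(** * Euclidean inner product *)


Lemma dotC (R : realType) (n : nat) (u v : 'rV[R]_n) : dot u v = dot v u.
Proof. by apply: eq_bigr => i _; rewrite mulrC. Qed.

Lemma dotDl (R : realType) (n : nat) (u v w : 'rV[R]_n) :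
  dot (u + v) w = dot u w + dot v w.
Proof. by rewrite -big_split; apply: eq_bigr => i _; rewrite mxE mulrDl. Qed.

Lemma dotZl (R : realType) (n : nat) (a : R) (u v : 'rV[R]_n) :
  dot (a *: u) v = a * dot u v.
Proof. by rewrite /dot mulr_sumr; apply: eq_bigr => i _; rewrite mxE mulrA. Qed.

Lemma dotNl (R : realType) (n : nat) (u v : 'rV[R]_n) :
  dot (- u) v = - dot u v.
Proof. by rewrite -scaleN1r dotZl mulN1r. Qed.

Lemma dotDr (R : realType) (n : nat) (u v w : 'rV[R]_n) :
  dot w (u + v) = dot w u + dot w v.
Proof. by rewrite !(dotC w) dotDl. Qed.

Lemma dotZr (R : realType) (n : nat) (a : R) (u v : 'rV[R]_n) :
  dot v (a *: u) = a * dot v u.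
Proof. by rewrite !(dotC v) dotZl. Qed.

Lemma dotNr (R : realType) (n : nat) (u v : 'rV[R]_n) :
  dot v (- u) = - dot v u.
Proof. by rewrite !(dotC v) dotNl. Qed.

Definition dotE := (dotDl, dotDr, dotNl, dotNr, dotZl, dotZr).

Lemma dot_ge0 (R : realType) (n : nat) (u : 'rV[R]_n) : 0 <= dot u u.
Proof. by apply: sumr_ge0 => i _; rewrite -expr2 sqr_ge0. Qed.

Lemma sqr_enorm (R : realType) (n : nat) (u : 'rV[R]_n) :
  enorm u ^+ 2 = dot u u.
Proof. by rewrite sqr_sqrtr // dot_ge0. Qed.

Lemma coord_sqr_le_dot (R : realType) (n : nat) (u : 'rV[R]_n) i :
  u ord0 i ^+ 2 <= dot u u.
Proof.
rewrite /dot (bigD1 i) //= -expr2 lerDl.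
by apply: sumr_ge0 => j _; rewrite -expr2 sqr_ge0.
Qed.

Lemma lipschitz_dot (R : realType) (n : nat) (L : R)
    (F : 'rV[R]_n -> 'rV[R]_n) x y :
  euclidean_lipschitz L F ->
  dot (F x - F y) (F x - F y) <= L ^+ 2 * dot (x - y) (x - y).
Proof.
move=> hF; rewrite -!sqr_enorm -exprMn lerXn2r ?nnegrE ?sqrtr_ge0 ?hF //.
exact: le_trans (sqrtr_ge0 _) (hF x y).
Qed.

(** * Continuity and nearest points *)

Lemma continuous_dot (R : realType) (T : topologicalType) (n : nat)
    (f g : T -> 'rV[R]_n) :
  (forall i, continuous (fun x => f x ord0 i)) ->
  (forall i, continuous (fun x => g x ord0 i)) ->
  continuous (fun x => dot (f x) (g x)).
Proof.
move=> cf cg; apply: (@continuous_big _ _ +%R); first exact: add_continuous.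
by move=> i _ x; apply: (@cvgM R); [exact: cf | exact: cg].
Qed.

Lemma continuous_coordB (R : realType) (T : topologicalType) (n : nat)
    (f g : T -> 'rV[R]_n) i :
  continuous (fun x => f x ord0 i) -> continuous (fun x => g x ord0 i) ->
  continuous (fun x => (f x - g x) ord0 i).
Proof.
move=> cf cg; rewrite (_ : (fun x => (f x - g x) ord0 i) =
  (fun x => f x ord0 i - g x ord0 i)); last by apply: funext => x; rewrite !mxE.
by move=> x; apply: cvgB; [exact: cf | exact: cg].
Qed.

Lemma continuous_coord_cst (R : realType) (T : topologicalType) (n : nat)
    (u : 'rV[R]_n) i : continuous (fun x : T => u ord0 i).
Proof. by move=> x; exact: cvg_cst. Qed.

(** The topology of row vectors is the product one, so continuity is phrased
    coordinatewise; the Euclidean Lipschitz bound enters through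
    (F x - F y)_i^2 <= L^2 |x - y|^2, whose right-hand side is continuous in y
    and vanishes at x. *)
Lemma lipschitz_coord_continuous (R : realType) (n : nat) (L : R)
    (F : 'rV[R]_n -> 'rV[R]_n) i :
  euclidean_lipschitz L F -> continuous (fun x => F x ord0 i).
Proof.
move=> hF x; apply/(@cvgrPdist_lt _ R^o _ (nbhs x) (nbhs_filter x)) => e e0.
have cd : continuous (fun y : 'rV[R]_n => dot (x - y) (x - y)).
  by apply: continuous_dot => j; apply: continuous_coordB;
    [exact: continuous_coord_cst | exact: coord_continuous
    |exact: continuous_coord_cst | exact: coord_continuous].
have FF := nbhs_filter x.
have /(@cvgrPdist_lt _ R^o _ _ FF) /(_ _ (exprn_gt0 2 e0)) :
    L ^+ 2 * dot (x - y) (x - y) @[y --> x] --> L ^+ 2 * dot (x - x) (x - x).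
  by apply: cvgMl_tmp; exact: cd.
rewrite subrr -[X in dot X _](scale0r 0) dotZl mul0r mulr0.
apply: (@filterS _ (nbhs x) FF) => y; rewrite sub0r normrN => hy.
have {}hy := le_lt_trans (ler_norm _) hy.
rewrite -(ltr_pXn2r (n := 2)) ?nnegrE ?normr_ge0 ?ltW // real_normK ?num_real //.
apply: le_lt_trans hy; apply: le_trans (lipschitz_dot x y hF).
by have := coord_sqr_le_dot (F x - F y) i; rewrite !mxE.
Qed.

(** Only the points of S that are no farther from p than a given y0 in S compete.
    They form a closed subset of a box, which is compact, and a continuous
    function attains its minimum there. *)
Lemma closed_exists_nearest (R : realType) (n : nat) (p : 'rV[R]_n)
    (S : set 'rV[R]_n) :
  closed S -> S !=set0 ->
  exists2 x, S x & forall y, S y -> dot (x - p) (x - p) <= dot (y - p) (y - p).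
Proof.
move=> cS [y0 Sy0].
set f := fun x : 'rV[R]_n => dot (x - p) (x - p).
have cf : continuous f.
  by apply: continuous_dot => j; apply: continuous_coordB;
    [exact: coord_continuous | exact: continuous_coord_cst
    |exact: coord_continuous | exact: continuous_coord_cst].
(* A radius larger than the distance from p to y0 that needs no square root:
   d <= d^2 + 1. *)
pose r := f y0 + 1.
have f0 : 0 <= f y0 by exact: dot_ge0.
pose K := S `&` f @^-1` [set t | t <= f y0].
have cK : compact K.
  apply: (@subclosed_compact _ K [set v : 'rV[R]_n |
      forall i, `[p ord0 i - r, p ord0 i + r]%classic (v ord0 i)]).
  - apply: closedI => //.
    by apply: preimage_closed (@closed_le R _) => x _; exact: cf.
  - apply: (@rV_compact R n (fun i => `[p ord0 i - r, p ord0 i + r]%classic)).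
    by move=> i; exact: segment_compact.
  - move=> x [_ /= fx] i; rewrite /= in_itv /=.
    have := coord_sqr_le_dot (x - p) i; rewrite !mxE -/(f x).
    rewrite /r => /le_trans/(_ fx) h.
    by apply/andP; split; nra.
have [||x /set_mem[Sx fx] xmin] := @compact_EVT_min _ _ f K _ cK.
- by exists y0; split => //=.
- exact: continuous_subspaceT.
exists x => // y Sy; have [fy|/ltW fy] := leP (f y) (f y0).
  by apply: xmin; apply/mem_set.
exact: le_trans fx fy.
Qed.

(** * Closedness from maximality *)

(** Otherwise adding (z, u) to the graph of A would be a strict monotone
    extension. *)
Lemma maximally_monotone_mem (R : realType) (n : nat) (A : operator R n)
    (z u : 'rV[R]_n) :
  maximally_monotone A ->
  (forall z' u', A z' u' -> 0 <= dot (u - u') (z - z')) -> A z u.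
Proof.
move=> [monA maxA] h; apply: contrapT => nA; apply: maxA.
exists (fun z' => A z' `|` [set u' | z' = z /\ u' = u]); split; last first.
  split; first by move=> [x v] /=; left.
  by move=> /(_ (z, u)) /= H; apply: nA; apply: H; right.
move=> x x' v v'; rewrite mul0r => -[Axv|[-> ->]] [Axv'|[-> ->]].
- by have := monA _ _ _ _ Axv Axv'; rewrite mul0r.
- by have := h _ _ Axv; rewrite -(opprB v) -(opprB x) dotNl dotNr opprK.
- exact: h.
- by rewrite subrr -[X in dot X _](scale0r 0) dotZl mul0r.
Qed.

(** With f constant this says that the values A(z) are closed; with f the identity
    and g = - F, that the zeros of F + A are. *)
Lemma maximally_monotone_closed_preimage (R : realType) (n : nat)
    (A : operator R n) (T : topologicalType) (f g : T -> 'rV[R]_n) :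
  maximally_monotone A ->
  (forall i, continuous (fun x => f x ord0 i)) ->
  (forall i, continuous (fun x => g x ord0 i)) ->
  closed [set x | A (f x) (g x)].
Proof.
move=> hA cf cg.
rewrite (_ : [set x | _] = \bigcap_(q in graph A)
    (fun x => dot (g x - q.2) (f x - q.1)) @^-1` [set t | 0 <= t]).
  apply: closed_bigI => q _; apply: preimage_closed (@closed_ge R _) => x _.
  by apply: continuous_dot => i; apply: continuous_coordB => //;
    exact: continuous_coord_cst.
apply/seteqP; split=> x /= Ax.
  by move=> q Aq /=; have := hA.1 _ _ _ _ Ax Aq; rewrite mul0r.
by apply: maximally_monotone_mem => // z' u' /(Ax (z', u')).
Qed.

Lemma zerE (R : realType) (n : nat) (F : 'rV[R]_n -> 'rV[R]_n)
    (A : operator R n) z : zer (op_add F A) z <-> A z (- F z).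
Proof.
split=> [[c Ac] /eqP|Az]; last by exists (- F z) => //; rewrite subrr.
by rewrite addrC addr_eq0 => /eqP <-.
Qed.

Lemma exists_nearest_zero (R : realType) (n : nat) (L : R)
    (F : 'rV[R]_n -> 'rV[R]_n) (A : operator R n) (z0 : 'rV[R]_n) :
  euclidean_lipschitz L F -> maximally_monotone A ->
  zer (op_add F A) !=set0 ->
  exists2 zs, zer (op_add F A) zs &
    is_min [set enorm (z0 - x) ^+ 2 | x in zer (op_add F A)]
           (enorm (z0 - zs) ^+ 2).
Proof.
move=> hF hA hzer.
have cl : closed (zer (op_add F A)).
  rewrite (_ : zer _ = [set x | A x (- F x)]); last first.
    by apply/funext => x; apply/propext/zerE.
  apply: maximally_monotone_closed_preimage => // i; first exact: coord_continuous.
  rewrite (_ : (fun x => (- F x) ord0 i) =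
      (fun x => (0 - F x) ord0 i)); last first.
    by under [RHS]eq_fun do rewrite sub0r.
  by apply: continuous_coordB;
    [exact: continuous_coord_cst | exact: lipschitz_coord_continuous hF].
have [zs Zzs zsmin] := closed_exists_nearest z0 cl hzer.
exists zs => //; split; first by exists zs.
move=> _ [x Zx <-]; rewrite !sqr_enorm -opprB -[z0 - x]opprB.
by rewrite !(dotNl, dotNr) !opprK; exact: zsmin.
Qed.

Lemma exists_tangent_residual (R : realType) (n : nat)
    (F : 'rV[R]_n -> 'rV[R]_n) (A : operator R n) (z : 'rV[R]_n) :
  maximally_monotone A -> A z !=set0 ->
  exists r, is_tangent_residual F A z r /\
    is_min [set enorm (F z + a) ^+ 2 | a in A z] (r ^+ 2).
Proof.
move=> hA Az0.
have cl : closed (A z).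
  apply: (@maximally_monotone_closed_preimage R n A _ (fun=> z) id) => // i;
    [exact: continuous_coord_cst | exact: coord_continuous].
have [a Aa amin] := closed_exists_nearest (- F z) cl Az0.
have le_min b : A z b -> dot (F z + a) (F z + a) <= dot (F z + b) (F z + b).
  by move=> /amin; rewrite opprK ![_ + F z]addrC.
exists (enorm (F z + a)); split; split; try by exists a.
  by move=> _ [b Ab <-]; rewrite ler_sqrt ?dot_ge0 ?le_min.
by move=> _ [b Ab <-]; rewrite !sqr_enorm le_min.
Qed.

(** * The Lyapunov function *)

Definition potential (R : realType) (n : nat) (eta rho : R) (z0 : 'rV[R]_n)
    (k : R) (z u : 'rV[R]_n) : R :=
  (eta / 2 * k ^+ 2 + rho * (k ^+ 2 - k)) * dot u u + k * dot u (z - z0).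

(** The decrease of the potential is an exact combination of the slacks of the two
    hypotheses. The comonotonicity hypothesis carries the factor k so that
    k = 0 is covered: there u need not be a value of F + A, since the scheme
    starts from c_0 = 0, which may lie outside A(z_0). *)
Lemma potential_step (R : realType) (n : nat) (eta rho k : R)
    (z0 z z' u u' w : 'rV[R]_n) (b := (k + 1)^-1) :
  0 <= k -> 0 <= eta ->
  z' = b *: z0 + (1 - b) *: z - eta *: w - (2 * (1 - b) * rho) *: u ->
  0 <= k * (dot (u' - u) (z' - z) - rho * dot (u' - u) (u' - u)) ->
  dot (u' - w) (u' - w) <= dot (w - (1 - b) *: u) (w - (1 - b) *: u) ->
  potential eta rho z0 (k + 1) z' u' <= potential eta rho z0 k z u.
Proof.
move=> k0 eta0 ez hmon hlip.
have k1 : k + 1 != 0 by lra.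
have hmon' : 0 <= (k + 1) *
    (k * (dot (u' - u) (z' - z) - rho * dot (u' - u) (u' - u))).
  by rewrite mulr_ge0 // addr_ge0.
have hlip' : 0 <= eta / 2 * (k + 1) ^+ 2 *
    (dot (w - (1 - b) *: u) (w - (1 - b) *: u) - dot (u' - w) (u' - w)).
  by rewrite !mulr_ge0 ?subr_ge0 ?exprn_ge0 ?invr_ge0 ?addr_ge0.
rewrite -subr_ge0.
suff -> : potential eta rho z0 k z u - potential eta rho z0 (k + 1) z' u' =
  (k + 1) * (k * (dot (u' - u) (z' - z) - rho * dot (u' - u) (u' - u))) +
  eta / 2 * (k + 1) ^+ 2 *
    (dot (w - (1 - b) *: u) (w - (1 - b) *: u) - dot (u' - w) (u' - w)).
  by rewrite addr_ge0.
rewrite /potential ez !dotE (dotC w u) (dotC w u') (dotC u' u) /b.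
by field.
Qed.

(** With s = eta + 2 rho, the hypotheses add up to
    (s k / 2) |u|^2 <= <u, z0 - zs>. Expanding
    0 <= |(s k / 2) u - (z0 - zs)|^2 then bounds (s k / 2)^2 |u|^2 by
    |z0 - zs|^2, without square roots. *)
Lemma potential_le0_residual (R : realType) (n : nat) (eta rho k : R)
    (z0 z zs u : 'rV[R]_n) :
  0 < k -> 0 < eta + 2 * rho ->
  potential eta rho z0 k z u <= 0 ->
  rho * dot u u <= dot u (z - zs) ->
  dot u u <= 4 / (eta + 2 * rho) ^+ 2 * (dot (z0 - zs) (z0 - zs) / k ^+ 2).
Proof.
move=> k0 s0 hV hmon.
set s := eta + 2 * rho in s0 *.
have key : s * k / 2 * dot u u <= dot u (z0 - zs).
  rewrite -(ler_pM2l k0); move: hV hmon; rewrite /potential !dotE /s => hV hmon.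
  have := ler_wpM2l (ltW k0) hmon; lra.
move: (z0 - zs) key => d key.
have sq : 0 <= s ^+ 2 * k ^+ 2 / 4 * dot u u - s * k * dot u d + dot d d.
  rewrite (_ : _ + _ = dot ((s * k / 2) *: u - d) ((s * k / 2) *: u - d)).
    exact: dot_ge0.
  by rewrite !dotE (dotC d u); field.
have sk : 0 < s * k by rewrite mulr_gt0.
have := ler_wpM2l (ltW sk) key => key'.
rewrite [leRHS](_ : _ = 4 * dot d d / (s * k) ^+ 2); last first.
  by field; rewrite !gt_eqF.
rewrite ler_pdivlMr ?exprn_gt0 //; lra.
Qed.

(** * The iterates of composite-FEG *)

Lemma FEG_c_mem (R : realType) (n : nat) (F : 'rV[R]_n -> 'rV[R]_n)
    (A : operator R n) (eta rho : R) (z0 : 'rV[R]_n)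
    (z zh c : nat -> 'rV[R]_n) k :
  0 < eta -> composite_FEG F A eta rho z0 z zh c -> A (z k.+1) (c k.+1).
Proof.
move=> eta0 hz; rewrite (FEG_c hz).
have [_ [a Aa <-] <-] := FEG_next hz k.
by rewrite addrAC subrr add0r scalerA mulVf ?scale1r // gt_eqF.
Qed.

Lemma FEG_update (R : realType) (n : nat) (F : 'rV[R]_n -> 'rV[R]_n)
    (A : operator R n) (eta rho : R) (z0 : 'rV[R]_n)
    (z zh c : nat -> 'rV[R]_n) k (b := FEG_beta R k) :
  0 < eta -> composite_FEG F A eta rho z0 z zh c ->
  z k.+1 = b *: z0 + (1 - b) *: z k - eta *: (F (zh k) + c k.+1)
           - (2 * (1 - b) * rho) *: (F (z k) + c k).
Proof.
move=> eta0 hz; rewrite scalerDr (FEG_c hz) scalerA mulfV ?gt_eqF // scale1r.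
rewrite /FEG_arg -/b.
by apply/rowP => i; rewrite !mxE; ring.
Qed.

(** The half step and the full step share the anchor and differ only by
    - eta (w - (1 - b) u_k), so the Lipschitz bound costs a factor
    L^2 eta^2 <= 1. *)
Lemma FEG_lipschitz_step (R : realType) (n : nat) (L : R)
    (F : 'rV[R]_n -> 'rV[R]_n)
    (A : operator R n) (eta rho : R) (z0 : 'rV[R]_n)
    (z zh c : nat -> 'rV[R]_n) k (b := FEG_beta R k)
    (w := F (zh k) + c k.+1) (u := fun k => F (z k) + c k) :
  0 < eta -> L ^+ 2 * eta ^+ 2 <= 1 -> euclidean_lipschitz L F ->
  composite_FEG F A eta rho z0 z zh c ->
  dot (u k.+1 - w) (u k.+1 - w) <= dot (w - (1 - b) *: u k) (w - (1 - b) *: u k).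
Proof.
move=> eta0 hL hF hz.
have -> : u k.+1 - w = F (z k.+1) - F (zh k).
  by rewrite /u /w opprD addrACA subrr addr0.
apply: le_trans (lipschitz_dot _ _ hF) _.
have -> : z k.+1 - zh k = (- eta) *: (w - (1 - b) *: u k).
  rewrite (FEG_update k eta0 hz) [X in _ - X = _](FEG_half hz) -/b /w /u.
  by apply/rowP => i; rewrite !mxE; ring.
move: (w - _) => v.
rewrite dotZl dotZr (_ : _ * _ = L ^+ 2 * eta ^+ 2 * dot v v); last by ring.
by rewrite -[leRHS]mul1r ler_wpM2r ?dot_ge0.
Qed.

Lemma FEG_potential_le0 (R : realType) (n : nat) (L : R)
    (F : 'rV[R]_n -> 'rV[R]_n)
    (A : operator R n) (eta rho : R) (z0 : 'rV[R]_n)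
    (z zh c : nat -> 'rV[R]_n) k :
  0 < eta -> L ^+ 2 * eta ^+ 2 <= 1 -> euclidean_lipschitz L F ->
  comonotone rho (op_add F A) ->
  composite_FEG F A eta rho z0 z zh c ->
  potential eta rho z0 k%:R (z k) (F (z k) + c k) <= 0.
Proof.
move=> eta0 hL hF hFA hz; elim: k => [|k IHk].
  by rewrite /potential expr0n subr0 !mulr0 addr0 !mul0r addr0.
apply: le_trans IHk; rewrite -natr1.
have bE : (k%:R + 1)^-1 = FEG_beta R k by rewrite natr1.
apply: (@potential_step R n _ _ _ _ _ _ _ _ (F (zh k) + c k.+1)).
- exact: ler0n.
- exact: ltW.
- by rewrite bE (FEG_update k eta0 hz).
- case: k {bE} => [|k]; first by rewrite mul0r.
  rewrite mulr_ge0 ?ler0n // subr_ge0 -sqr_enorm.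
  by apply: hFA; (eexists; first exact: FEG_c_mem eta0 hz).
- by rewrite bE; apply: (FEG_lipschitz_step _ eta0 hL hF hz).
Qed.

Theorem theorem4p1 (R : realType) (n : nat) (L rho eta : R)
    (F : 'rV[R]_n -> 'rV[R]_n) (A : operator R n)
    (z0 : 'rV[R]_n) (z zh c : nat -> 'rV[R]_n)
    (hL : 0 < L)
    (hrho : - (1 / (2 * L)) < rho /\ rho <= 0)
    (hF : euclidean_lipschitz L F)
    (hA : maximally_monotone A)
    (hFA : comonotone rho (op_add F A))
    (hzer : zer (op_add F A) !=set0)
    (heta : Num.max 0 (- 2 * rho) < eta /\ eta <= 1 / L)
    (hz : composite_FEG F A eta rho z0 z zh c) :
  exists H0 : R,
    is_min [set enorm (z0 - zs) ^+ 2 | zs in zer (op_add F A)] (H0 ^+ 2) /\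
    forall T : nat, (1 <= T)%N ->
      exists r : R,
        [/\ is_tangent_residual F A (z T) r,
            is_min [set enorm (F (z T) + a) ^+ 2 | a in A (z T)] (r ^+ 2) &
            r ^+ 2 <= 4 / ((eta + 2 * rho) ^+ 2 * L ^+ 2)
                      * (H0 ^+ 2 * L ^+ 2 / T%:R ^+ 2)].
Proof.
have [+ hetaL] := heta; rewrite gt_max => /andP[eta0 hrho2].
have s0 : 0 < eta + 2 * rho by lra.
have etaL : L ^+ 2 * eta ^+ 2 <= 1.
  have Leta0 : 0 <= L * eta by rewrite mulr_ge0 // ltW.
  by rewrite -exprMn expr_le1 // mulrC -ler_pdivlMr.
have [zs Zzs zsmin] := exists_nearest_zero z0 hF hA hzer.
exists (enorm (z0 - zs)); split=> // T T1.
have AT : A (z T) (c T) by case: T T1 => // T _; exact: FEG_c_mem eta0 hz.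
have [r [rmin r2min]] := exists_tangent_residual F hA (ex_intro _ _ AT).
exists r; split=> //.
apply: (@le_trans _ _ (enorm (F (z T) + c T) ^+ 2)).
  by apply: r2min.2; exists (c T).
have T0 : (0 : R) < T%:R by rewrite ltr0n.
rewrite !sqr_enorm.
rewrite [leRHS](_ : _ = 4 / (eta + 2 * rho) ^+ 2 *
    (dot (z0 - zs) (z0 - zs) / T%:R ^+ 2)); last first.
  by field; rewrite !gt_eqF.
apply: (@potential_le0_residual R n _ _ _ _ (z T)) => //.
  exact: FEG_potential_le0 eta0 etaL hF hFA hz.
have := hFA (z T) zs _ _ (ex_intro2 _ _ _ AT erefl) Zzs.
by rewrite subr0 sqr_enorm.
Qed.
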